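(* There is a function $n:\mathbb{N}_{\ge1}\to\mathbb{N}$ with $n(k)=k(1+o(1))$ as $k\to\infty$ such that for every positive integer $k$ there exists a classical-quantum state $\rho_{XE}$ with $X\in\{0,1\}^{n(k)}$ such that $\rho_{XE}\in CQ(k)$ while $d(\rho_{XE},CC(2))\ge0.98$.
   Context: A classical-quantum (cq) state is $\rho_{XE}=\sum_x|x\rangle\langle x|\otimes\rho_x$ with positive semidefinite operators $\rho_x$ on a finite-dimensional space $\mathcal{E}$ satisfying $\sum_x\mathrm{Tr}\,\rho_x=1$. Logarithms are base 2. For a cq state, $p_g(X|E)_\rho=\max\sum_x\mathrm{Tr}[M_x\rho_x]$ over POVMs $\{M_x\}$ on $\mathcal{E}$ is the optimal guessing probability. For a classical joint distribution $XY$, $p_g(X|Y)=\sum_y\max_x\Pr[X=x,Y=y]$. $CQ(k)$ is the set of all cq states $\rho_{XE}$ with $-\log p_g(X|E)_\rho\ge k$. $CC(k)$ is the set of all cq states $\rho_{XE}$ that can be generated from a classical joint distribution $XY$ ($Y$ with finite range) with $-\log p_g(X|Y)\ge k$ by a quantum channel acting only on the $Y$ part. $d(\rho,CC(k))$ is the distance from $\rho$ to the states in $CC(k)$ on the same space, i.e. the infimum of $\|\rho-\sigma\|_{tr}$, where $\|K\|_{tr}=\mathrm{Tr}\sqrt{K^\dagger K}$ (no factor $1/2$). *)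

(* Defs.v *)
From HB Require Import structures.
From mathcomp Require Import all_boot all_order all_algebra.
From mathcomp Require Import spectral sesquilinear.
From mathcomp Require Import all_classical all_reals all_analysis.
From mathcomp Require Export complex.
From mathcomp Require mxtens.
Import Order.TTheory GRing.Theory Num.Theory.
Import numFieldNormedType.Exports.

Set Implicit Arguments.
Unset Strict Implicit.
Unset Printing Implicit Defensive.

Local Open Scope classical_set_scope.
Local Open Scope complex_scope.
Local Open Scope sesquilinear_scope.
Local Open Scope ring_scope.

(* mxtens is not imported because its notation [A ^t k] clashes with the one
   of sesquilinear. *)
Local Notation "A *t B" := (mxtens.tensmx A B)
  (at level 40, left associativity) : ring_scope.
Local Notation mxtens_index := mxtens.mxtens_index.

Section Operators.
Context {R : realType}.
Local Notation C := R[i].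

Definition psdmx (d : nat) (A : 'M[C]_d) : Prop :=
  A \is hermsymmx /\ forall v : 'cV[C]_d, 0 <= (v^t* *m A *m v) 0 0.

(* The square root of a normal matrix, by functional calculus on the spectral
   decomposition of the library (see [sqrtmxK]); on a positive semidefinite
   matrix it is the positive semidefinite square root. *)
Definition sqrtmx (d : nat) (A : 'M[C]_d) : 'M[C]_d :=
  invmx (spectralmx A) *m diag_mx (map_mx sqrtC (spectral_diag A))
    *m spectralmx A.

Lemma sqrtmxK (d : nat) (A : 'M[C]_d) :
  A \is normalmx -> sqrtmx A *m sqrtmx A = A.
Proof.
move=> nA; have Pu : spectralmx A \in unitmx.
  by apply: unitarymx_unit; exact: spectral_unitarymx.
rewrite /sqrtmx !mulmxA mulmxK // -(mulmxA _ (diag_mx _) (diag_mx _)) mulmx_diag.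
rewrite [RHS](orthomx_spectralP nA).
by congr (_ *m diag_mx _ *m _); apply/rowP => j; rewrite !mxE -expr2 sqrtCK.
Qed.

(* The trace is taken in C, where it is a nonnegative real. *)
Definition trnorm (d : nat) (K : 'M[C]_d) : R :=
  complex.Re (\tr (sqrtmx (K^t* *m K))).

(* The block (<i| (x) 1) M (|j> (x) 1). *)
Definition mxblk (n d : nat) (M : 'M[C]_(n * d)) (i j : 'I_n) : 'M[C]_d :=
  \matrix_(a, b) M (mxtens_index (i, a)) (mxtens_index (j, b)).

(* The map id (x) Phi on n-by-n block matrices. *)
Definition idtens (n m d : nat) (Phi : 'M[C]_m -> 'M[C]_d)
    (M : 'M[C]_(n * m)) : 'M[C]_(n * d) :=
  \sum_(i < n) \sum_(j < n) delta_mx i j *t Phi (mxblk M i j).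

Definition quantum_channel (m d : nat)
    (Phi : {linear 'M[C]_m -> 'M[C]_d}) : Prop :=
  (forall (n : nat) (M : 'M[C]_(n * m)), psdmx M -> psdmx (idtens Phi M)) /\
  (forall A : 'M[C]_m, \tr (Phi A) = \tr A).

End Operators.

Section CQ.
Context {R : realType} {X : finType}.
Local Notation C := R[i].

Definition log2 (x : R) : R := ln x / ln 2.

(* A cq state is given by its family of blocks; the operator
   sum_x |x><x| (x) rho_x on the joint system is [cqop]. *)
Definition cqop (d : nat) (rho : X -> 'M[C]_d) : 'M[C]_(#|X| * d) :=
  \sum_(x : X) delta_mx (enum_rank x) (enum_rank x) *t rho x.

Definition cqstate (d : nat) (rho : X -> 'M[C]_d) : Prop :=
  (forall x, psdmx (rho x)) /\ \sum_(x : X) \tr (rho x) = 1.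

Definition povm (d : nat) (M : X -> 'M[C]_d) : Prop :=
  (forall x, psdmx (M x)) /\ \sum_(x : X) M x = 1%:M.

(* The traces are real for positive semidefinite operators, and the supremum
   is attained since the set of POVMs is compact. *)
Definition pguess (d : nat) (rho : X -> 'M[C]_d) : R :=
  sup [set complex.Re (\sum_(x : X) \tr (M x *m rho x)) | M in povm (d := d)].

Definition joint_distr (m : nat) (P : X -> 'I_m -> R) : Prop :=
  (forall x y, 0 <= P x y) /\ \sum_(x : X) \sum_(y < m) P x y = 1.

Definition pguess_cl (m : nat) (P : X -> 'I_m -> R) : R :=
  \sum_(y < m) \big[Num.max/0]_(x : X) P x y.

(* The operator sum_(x, y) P x y |x><x| (x) |y><y| *)
Definition clop (m : nat) (P : X -> 'I_m -> R) : 'M[C]_(#|X| * m) :=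
  cqop (fun x => \sum_(y < m) (P x y)%:C *: delta_mx y y).

Definition CQ (d : nat) (k : R) : set (X -> 'M[C]_d) :=
  [set rho | cqstate rho /\ k <= - log2 (pguess rho)].

Definition CC (d : nat) (k : R) : set (X -> 'M[C]_d) :=
  [set sigma | cqstate sigma /\
    exists (m : nat) (P : X -> 'I_m -> R) (Phi : {linear 'M[C]_m -> 'M[C]_d}),
      [/\ joint_distr P, k <= - log2 (pguess_cl P), quantum_channel Phi
        & cqop sigma = idtens Phi (clop P)]].

(* In the extended reals, so that the distance to the empty set is +oo. *)
Definition trdist (d : nat) (rho : X -> 'M[C]_d) (S : set (X -> 'M[C]_d)) :
    \bar R :=
  ereal_inf [set (trnorm (cqop rho - cqop sigma))%:E | sigma in S].

End CQ.

(* Main.v *)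
Require Import Defs.
From mathcomp Require Import all_boot all_order all_algebra.
From mathcomp Require Import all_classical all_reals all_analysis.
From mathcomp Require Import spectral sesquilinear.
From mathcomp Require mxtens.
From mathcomp Require Import finfield.
From mathcomp Require Import zify lra ring.
Import Order.TTheory GRing.Theory Num.Theory.
Import numFieldNormedType.Exports.

Set Implicit Arguments.
Unset Strict Implicit.
Unset Printing Implicit Defensive.

Local Open Scope classical_set_scope.
Local Open Scope complex_scope.
Local Open Scope sesquilinear_scope.
Local Open Scope ring_scope.

(** Let [F] be the field with [q = 2 ^ m] elements and, for a polynomial [f] of
    degree [< r] over [F], let [psi_f] be the uniform superposition of the points
    [(a, f a)] of its graph.  Two such unit vectors have overlap at most
    [(r - 1) / q <= 1 / 4], while the [2 ^ (m r)] equiprobable states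
    [psi_f psi_f^*] live in dimension [q ^ 2], so that [f] is guessed with
    probability at most [2 ^ (2 m - m r)].  If a state of [CC 2] is made from
    [P(x, y)] and density operators [tau_y], then its overlap with the projector
    [T = sum_x |x><x| (x) psi_x psi_x^*] is the sum over [y] of
    [Tr (tau_y A_y)] with [A_y = sum_x P(x, y) psi_x psi_x^*], and near
    orthogonality bounds the norm of [A_y] by [max_x P(x, y) + P(y) / 4].
    The overlap is therefore at most [1 / 4 + 1 / 4], against [1] for the given
    state, and testing with the unitary [2 T - 1] gives trace distance at least
    [1].  The choice [m ~ log k], [r ~ k / m] makes [m r = k (1 + o(1))]. *)

(** * Hermitian inner product, rank-one projectors and spectral bounds on traces *)

Section InnerProduct.
Context {C : numClosedFieldType}.

Definition dotc n (u v : 'cV[C]_n) : C := (u^t* *m v) 0 0.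

Lemma dotcE n (u v : 'cV[C]_n) : dotc u v = \sum_i (u i 0)^* * v i 0.
Proof. by rewrite /dotc !mxE; apply: eq_bigr => i _; rewrite !mxE. Qed.

Lemma dotcC n (u v : 'cV[C]_n) : (dotc u v)^* = dotc v u.
Proof.
rewrite !dotcE rmorph_sum; apply: eq_bigr => i _.
by rewrite rmorphM /= conjCK mulrC.
Qed.

Lemma dotc_ge0 n (u : 'cV[C]_n) : 0 <= dotc u u.
Proof.
by rewrite dotcE; apply: sumr_ge0 => i _; rewrite mulrC mul_conjC_ge0.
Qed.

Lemma dotc_sumr n (I : finType) (F : I -> 'cV[C]_n) (u : 'cV[C]_n) :
  dotc u (\sum_i F i) = \sum_i dotc u (F i).
Proof. by rewrite /dotc mulmx_sumr summxE. Qed.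

Lemma dotcZr n (a : C) (u v : 'cV[C]_n) : dotc u (a *: v) = a * dotc u v.
Proof. by rewrite /dotc -scalemxAr mxE. Qed.

Lemma dotcZl n (a : C) (u v : 'cV[C]_n) : dotc (a *: u) v = a^* * dotc u v.
Proof. by rewrite -dotcC dotcZr rmorphM /= dotcC. Qed.

Lemma dotc_suml n (I : finType) (F : I -> 'cV[C]_n) (u : 'cV[C]_n) :
  dotc (\sum_i F i) u = \sum_i dotc (F i) u.
Proof.
by rewrite -dotcC dotc_sumr rmorph_sum; apply: eq_bigr => i _; rewrite /= dotcC.
Qed.

Lemma trmxC_mul m n p (A : 'M[C]_(m, n)) (B : 'M[C]_(n, p)) :
  (A *m B)^t* = B^t* *m A^t*.
Proof. by rewrite trmx_mul map_mxM. Qed.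

Lemma dotc_mulr m n (A : 'M[C]_(m, n)) (u : 'cV[C]_m) (v : 'cV[C]_n) :
  dotc u (A *m v) = dotc (A^t* *m u) v.
Proof. by rewrite /dotc trmxC_mul trmxCK mulmxA. Qed.

Lemma dotc_CauchySchwarz n (u v : 'cV[C]_n) :
  `|dotc u v| ^+ 2 <= dotc u u * dotc v v.
Proof.
have E (a b : 'cV[C]_n) : dotc a b = dotmx (a^t*) (b^t*).
  by rewrite dotmxE trmxCK.
by rewrite !E; apply: CauchySchwarz.
Qed.

Definition proj1mx n (u : 'cV[C]_n) : 'M[C]_n := u *m u^t*.

Lemma proj1mxE n (u v : 'cV[C]_n) : proj1mx u *m v = dotc u v *: u.
Proof.
rewrite /proj1mx -mulmxA /dotc [u^t* *m v]mx11_scalar mul_mx_scalar.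
by rewrite -mx11_scalar.
Qed.

Lemma proj1mx_sandwich n (u v : 'cV[C]_n) :
  dotc v (proj1mx u *m v) = `|dotc u v| ^+ 2.
Proof. by rewrite proj1mxE dotcZr -[dotc v u]dotcC normCK. Qed.

Lemma proj1mx_herm n (u : 'cV[C]_n) : (proj1mx u)^t* = proj1mx u.
Proof. by rewrite /proj1mx trmxC_mul trmxCK. Qed.

Lemma mxtrace_proj1mx n (u : 'cV[C]_n) : \tr (proj1mx u) = dotc u u.
Proof. by rewrite /proj1mx mxtrace_mulC /mxtrace big_ord1. Qed.

Lemma proj1mx_idem n (u : 'cV[C]_n) :
  dotc u u = 1 -> proj1mx u *m proj1mx u = proj1mx u.
Proof.
by move=> u1; rewrite [X in _ *m X]/proj1mx mulmxA proj1mxE u1 scale1r.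
Qed.

Lemma diag_conj_dotc m n (P : 'M[C]_(m, n)) (A : 'M[C]_n) i :
  (P *m A *m P^t*) i i = dotc (col i (P^t*)) (A *m col i (P^t*)).
Proof.
rewrite /dotc -mulmxA !mxE; apply: eq_bigr => j _.
rewrite !mxE conjCK; congr (_ * _).
by apply: eq_bigr => k _; rewrite !mxE.
Qed.

Lemma dotc_col_unitary n (P : 'M[C]_n) i :
  P \is unitarymx -> dotc (col i (P^t*)) (col i (P^t*)) = 1.
Proof.
move=> /unitarymxP PP; have := diag_conj_dotc P 1%:M i.
by rewrite mulmx1 PP mul1mx mxE eqxx => <-.
Qed.

Lemma mxtrace_unitary n (P A : 'M[C]_n) :
  P \is unitarymx ->
  \tr A = \sum_i dotc (col i (P^t*)) (A *m col i (P^t*)).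
Proof.
move=> uP; under eq_bigr do rewrite -diag_conj_dotc.
rewrite -/(mxtrace _) mxtrace_mulC mulmxA.
have /unitarymxP := uP; rewrite -{1}[P]trmxCK.
(* Cycling the trace leaves [P^t* *m P *m A], and unitarity of [P^t*] gives [P^t* *m P = 1]. *)
move: uP; rewrite -trmxC_unitary => /unitarymxP; rewrite trmxCK => -> _.
by rewrite mul1mx.
Qed.

(** The spectral theorem writes [A] as P^-1 D P with P unitary, so the columns of P^* are the
    orthonormal eigenvectors. *)
Lemma spectral_diag_dotc n (A : 'M[C]_n) i :
  A \is normalmx ->
  let w := col i ((spectralmx A)^t*) in dotc w (A *m w) = spectral_diag A 0 i.
Proof.
move=> /orthomx_spectralP nA w; rewrite -diag_conj_dotc.
have uP := spectral_unitarymx A.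
rewrite {2}nA invmx_unitary // !mulmxA (unitarymxP uP) mul1mx.
by rewrite -mulmxA (unitarymxP uP) mulmx1 mxE eqxx mulr1n.
Qed.

Lemma spectral_col_eigen n (A : 'M[C]_n) i :
  A \is normalmx ->
  let w := col i ((spectralmx A)^t*) in A *m w = spectral_diag A 0 i *: w.
Proof.
move=> /orthomx_spectralP nA w.
have uP := spectral_unitarymx A.
rewrite {1}nA invmx_unitary // /w !colE mulmxA.
rewrite -(mulmxA _ (spectralmx A)) (unitarymxP uP) mulmx1 mul_mx_diag -!colE.
by apply/colP => j; rewrite !mxE mulrC.
Qed.

(** In an eigenbasis of [B] the trace is the sum of the nonnegative eigenvalues of [B], each
    weighted by the quadratic form of [A] at a unit vector, hence by at most [l]. *)
Lemma mxtrace_psd_le n (A B : 'M[C]_n) (l : C) :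
  B \is normalmx -> (forall v, 0 <= dotc v (B *m v)) ->
  (forall v, dotc v (A *m v) <= l * dotc v v) ->
  \tr (B *m A) <= l * \tr B.
Proof.
move=> nB B0 Al; have uP := spectral_unitarymx B.
rewrite mxtrace_mulC !(mxtrace_unitary _ uP) mulr_sumr.
apply: ler_sum => i _; rewrite -mulmxA spectral_col_eigen //.
have := B0 (col i ((spectralmx B)^t*)).
rewrite spectral_col_eigen // -scalemxAr !dotcZr => D0.
rewrite dotc_col_unitary // mulr1 in D0 *; rewrite mulrC ler_wpM2r //.
by rewrite (le_trans (Al _)) // dotc_col_unitary // mulr1.
Qed.

(* Each eigenvector [w] of [K^* K] contributes [<U w, K w>] to the trace, which
   is at most the singular value [|K w|] since [|U w| = |w|]. *)
Lemma mxtrace_mul_le_singular n (U K : 'M[C]_n) :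
  U^t* = U -> U *m U = 1%:M ->
  `|\tr (U *m K)| <= \sum_i sqrtC (spectral_diag (K^t* *m K) 0 i).
Proof.
move=> hU UU; have uP := spectral_unitarymx (K^t* *m K).
have nK : K^t* *m K \is normalmx.
  by apply/normalmxP; rewrite trmxC_mul trmxCK.
rewrite (mxtrace_unitary _ uP); apply: (le_trans (ler_norm_sum _ _ _)).
apply: ler_sum => i _; rewrite -spectral_diag_dotc //.
set w := col i _; rewrite -mulmxA dotc_mulr -[K^t* *m K *m w]mulmxA.
rewrite [dotc w _]dotc_mulr trmxCK.
rewrite -(ler_pXn2r (ltn0Sn 1)) ?nnegrE ?sqrtC_ge0 ?normr_ge0 ?dotc_ge0 //.
rewrite sqrtCK; apply: (le_trans (dotc_CauchySchwarz _ _)).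
by rewrite -dotc_mulr hU mulmxA UU mul1mx dotc_col_unitary // mul1r.
Qed.

End InnerProduct.

(** * Operator norm bound for mixtures of nearly orthogonal unit vectors *)

Section NearlyOrthogonal.
Context {C : numClosedFieldType} {X : finType} (d : nat).
Variables (psi : X -> 'cV[C]_d) (eps : C).
Hypothesis psi1 : forall x, dotc (psi x) (psi x) = 1.
Hypothesis psi_eps : forall x y, x != y -> `|dotc (psi x) (psi y)| <= eps.
Hypothesis eps0 : 0 <= eps.

(** Expand the double sum: the diagonal gives the squares, and each off-diagonal term is at most
    [eps] times a product of moduli. Adding the missing nonnegative diagonal products completes the
    square. *)
Lemma nearly_orthogonal_dotc (a : X -> C) :
  dotc (\sum_x a x *: psi x) (\sum_x a x *: psi x) <=
  \sum_x `|a x| ^+ 2 + eps * (\sum_x `|a x|) ^+ 2.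
Proof.
rewrite -[leLHS]ger0_norm ?dotc_ge0 //.
have -> : dotc (\sum_x a x *: psi x) (\sum_x a x *: psi x) =
    \sum_x \sum_y (a x)^* * (a y * dotc (psi x) (psi y)).
  rewrite dotc_suml; apply: eq_bigr => x _; rewrite dotc_sumr.
  by apply: eq_bigr => y _; rewrite dotcZl dotcZr.
rewrite expr2 big_distrl mulr_sumr -big_split /=.
apply: (le_trans (ler_norm_sum _ _ _)); apply: ler_sum => x _.
apply: (le_trans (ler_norm_sum _ _ _)).
rewrite (bigD1 x) //= psi1 mulr1 normrM norm_conjC -expr2 lerD2l.
rewrite mulrCA mulr_sumr mulr_sumr [leRHS](bigD1 x) //= -[leLHS]add0r lerD //.
  by rewrite !mulr_ge0.
apply: ler_sum => y yx; rewrite 2!normrM norm_conjC ler_wpM2l //.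
by rewrite mulrC ler_wpM2r // psi_eps // eq_sym.
Qed.

(* With [w = A v] one has [<v, A v> = <v, w>], so Cauchy-Schwarz and the bound
   of [nearly_orthogonal_dotc] on [<w, w>] bound the square of [<v, A v>] by a
   multiple of [<v, A v>] itself. *)
Lemma nearly_orthogonal_opbound (p : X -> C) (pmax : C) (v : 'cV[C]_d) :
  0 <= pmax -> (forall x, 0 <= p x <= pmax) ->
  dotc v ((\sum_x p x *: proj1mx (psi x)) *m v) <=
  (pmax + eps * \sum_x p x) * dotc v v.
Proof.
move=> pm0 pP; have p0 x : 0 <= p x by case/andP: (pP x).
have pm x : p x <= pmax by case/andP: (pP x).
set A := \sum_x _; set S := dotc _ _; pose c x := dotc (psi x) v.
have Av : A *m v = \sum_x (p x * c x) *: psi x.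
  rewrite mulmx_suml; apply: eq_bigr => x _.
  by rewrite -scalemxAl proj1mxE scalerA.
have SE : S = \sum_x p x * `|c x| ^+ 2.
  rewrite /S Av dotc_sumr; apply: eq_bigr => x _.
  by rewrite dotcZr -mulrA -[dotc v _]dotcC normCK.
have t0 x : 0 <= p x * `|c x| ^+ 2 by rewrite mulr_ge0 ?exprn_ge0.
have S0 : 0 <= S by rewrite SE sumr_ge0.
have dv0 := dotc_ge0 v.
have [->|Sn0] := eqVneq S 0.
  by rewrite mulr_ge0 // addr_ge0 ?mulr_ge0 ?sumr_ge0.
have Spos : 0 < S by rewrite lt_def Sn0.
rewrite -(ler_pM2r Spos).
apply: (@le_trans _ _ (dotc v v * dotc (A *m v) (A *m v))).
  apply: le_trans (dotc_CauchySchwarz _ _).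
  by rewrite -/S ger0_norm // expr2.
rewrite -[leRHS]mulrA [leRHS]mulrCA ler_wpM2l // Av.
apply: (le_trans (nearly_orthogonal_dotc _)).
rewrite mulrDl -[eps * _ * S]mulrA lerD ?ler_wpM2l //.
  rewrite SE mulr_sumr; apply: ler_sum => x _.
  rewrite normrM exprMn (ger0_norm (p0 x)) expr2 -mulrA.
  by rewrite ler_wpM2r // mulr_ge0 ?exprn_ge0.
(* What remains is a weighted Cauchy-Schwarz inequality, (sum p|c|)^2 <= (sum p)(sum p|c|^2). After
   doubling, it follows termwise from 2|c x||c y| <= |c x|^2 + |c y|^2. *)
rewrite SE expr2 -(ler_pM2l (ltr0n C 2)) /=.
apply: (@le_trans _ _ (\sum_x \sum_y
    (p x * p y * `|c x| ^+ 2 + p x * p y * `|c y| ^+ 2))); last first.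
  under [leLHS]eq_bigr do rewrite big_split /=.
  rewrite big_split /= [X in X + _]exchange_big /= mulr_natl mulr2n.
  rewrite big_distrl /= lerD // le_eqVlt; apply/orP; left; apply/eqP.
    apply: eq_bigr => x _; rewrite mulr_sumr; apply: eq_bigr => y _.
    by rewrite mulrA [p y * _]mulrC.
  apply: eq_bigr => x _; rewrite mulr_sumr; apply: eq_bigr => y _.
  by rewrite mulrA.
rewrite big_distrlr mulr_sumr; apply: ler_sum => x _.
rewrite mulr_sumr; apply: ler_sum => y _.
rewrite !normrM !(ger0_norm (p0 _)) -mulrDr /= mulrACA.
rewrite [leLHS]mulrCA ler_wpM2l ?mulr_ge0 //.
rewrite -subr_ge0 addrAC.
have -> : `|c x| ^+ 2 - 2 * (`|c x| * `|c y|) + `|c y| ^+ 2 =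
   (`|c x| - `|c y|) ^+ 2 by ring.
by rewrite -realEsqr rpredB ?normr_real.
Qed.

End NearlyOrthogonal.

(** * Nearly orthogonal vectors from graphs of low-degree polynomials *)

Section PolynomialCode.

Lemma card_poly_agree (F : finFieldType) (f g : {poly F}) r :
  f != g -> (size f <= r)%N -> (size g <= r)%N ->
  (#|[pred a | f.[a] == g.[a]]| <= r.-1)%N.
Proof.
move=> fg sf sg; have fg0 : f - g != 0 by rewrite subr_eq0.
have sfg : (size (f - g)%R <= r)%N.
  by rewrite (leq_trans (size_polyD _ _)) // size_polyN geq_max sf sg.
have := max_poly_roots fg0 (rs := enum [pred a | f.[a] == g.[a]]).
rewrite enum_uniq -cardE => /(_ _ isT) H.
suff /H lt : all (root (f - g)) (enum [pred a | f.[a] == g.[a]]).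
  by rewrite -ltnS (leq_trans (leq_trans lt sfg)) ?leqSpred.
apply/allP => a; rewrite mem_enum inE /root !hornerE subr_eq0; exact: id.
Qed.

Lemma exists_injective (S T : finType) :
  (#|S| <= #|T|)%N -> exists f : S -> T, injective f.
Proof.
move=> ST; exists (fun x => enum_val (widen_ord ST (enum_rank x))) => x y.
by move=> /enum_val_inj/(congr1 val)/= /val_inj /enum_rank_inj.
Qed.

Definition graph_vec {C : numClosedFieldType} {F : finFieldType} (f : F -> F) :
    'cV[C]_#|{: F * F}| :=
  \col_i (sqrtC (#|F|%:R^-1) * (f (enum_val i).1 == (enum_val i).2)%:R).

(** The two graphs share one point for each argument where the functions agree, and each shared
    point contributes 1/q. *)
Lemma dotc_graph_vec {C : numClosedFieldType} {F : finFieldType} (f g : F -> F) :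
  dotc (graph_vec f) (graph_vec g) =
  #|[pred a | f a == g a]|%:R / #|F|%:R :> C.
Proof.
rewrite dotcE [RHS]mulrC.
pose G (ab : F * F) : C := (f ab.1 == ab.2)%:R * (g ab.1 == ab.2)%:R.
have -> : #|[pred a | f a == g a]|%:R = \sum_ab G ab.
  rewrite -(pair_bigA _ (fun a b => G (a, b))) /= /G /=.
  rewrite -sum1_card natr_sum big_mkcond /=; apply: eq_bigr => a _.
  rewrite (bigD1 (f a)) //= eqxx mul1r big1 ?addr0.
    by rewrite inE eq_sym; case: eqP.
  by move=> b /negPf; rewrite eq_sym => ->; rewrite mul0r.
rewrite (reindex (@enum_rank _)) /=; last exact/onW_bij/enum_rank_bij.
rewrite mulr_sumr; apply: eq_bigr => i _.
rewrite /G !mxE enum_rankK rmorphM /= conjC_nat.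
have q0 : 0 <= #|F|%:R^-1 :> C by rewrite invr_ge0.
rewrite (geC0_conj _) ?sqrtC_ge0 // mulrACA -expr2 sqrtCK.
by [].
Qed.

(** Elements of [X] become coefficient lists of length [r] over the field with 2^m elements. The
    dimension is born as [#|{: F * F}|]; giving its value by a separate equation avoids casting the
    vectors. *)
Lemma exists_nearly_orthogonal (C : numClosedFieldType) (X : finType) m r :
  (0 < m)%N -> (#|X| <= 2 ^ (m * r))%N -> (4 * r.-1 <= 2 ^ m)%N ->
  exists d, d = (2 ^ (m + m))%N /\ exists psi : X -> 'cV[C]_d,
    (forall x, dotc (psi x) (psi x) = 1) /\
    (forall x y, x != y -> `|dotc (psi x) (psi y)| <= 4%:R^-1).
Proof.
move=> m0 Xr rm; have [F _ Fq] := PrimePowerField (isT : prime 2) m0.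
have [|t t_inj] := @exists_injective X (r.-tuple F).
  by rewrite card_tuple Fq -expnM.
exists #|{: F * F}|; split; first by rewrite card_prod Fq expnD.
exists (fun x => graph_vec (fun a => (Poly (t x)).[a])); split => [x|x y xy].
  rewrite dotc_graph_vec (eq_card (B := F)) => [|a].
    by rewrite divff // Fq pnatr_eq0 -lt0n expn_gt0.
  by rewrite !inE eqxx.
rewrite dotc_graph_vec ger0_norm ?divr_ge0 //.
have q0 : 0 < #|F|%:R :> C by rewrite Fq ltr0n expn_gt0.
rewrite ler_pdivrMr // mulrC ler_pdivlMr // -natrM ler_nat Fq.
apply: leq_trans rm; rewrite mulnC leq_mul2l /=.
have st z : (size (Poly (t z)) <= r)%N.
  by rewrite (leq_trans (size_Poly _)) // size_tuple.
apply: card_poly_agree => //; apply: contra xy => /eqP E; apply/eqP/t_inj.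
(* [Poly] forgets trailing zeros, but the common length [r] of the tuples restores them. *)
apply/val_inj/(@eq_from_nth _ 0); rewrite ?size_tuple // => i _.
by have := congr1 (fun p : {poly F} => p`_i) E; rewrite !coef_Poly.
Qed.

End PolynomialCode.

(** * Trace norm, positive semidefinite operators, channels and block-diagonal operators *)

Section Operators.
Context {R : realType}.
Local Notation C := R[i].
Local Notation "A *t B" := (mxtens.tensmx A B)
  (at level 40, left associativity) : ring_scope.
Local Notation mxtens_index := mxtens.mxtens_index.

Lemma le_Re (a b : C) : a <= b -> complex.Re a <= complex.Re b.
Proof. by rewrite lecE => /andP[]. Qed.

Lemma trnormE n (K : 'M[C]_n) :
  trnorm K = complex.Re (\sum_i sqrtC (spectral_diag (K^t* *m K) 0 i)).
Proof.
rewrite /trnorm /sqrtmx -mulmxA mxtrace_mulC mulmxK ?spectral_unit //.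
by rewrite mxtrace_diag; under eq_bigr do rewrite mxE.
Qed.

(** Lower half of the variational formula for the trace norm, tested on a Hermitian unitary. *)
Lemma trnorm_ge n (U K : 'M[C]_n) (c : R) :
  U^t* = U -> U *m U = 1%:M -> c%:C <= \tr (U *m K) -> c <= trnorm K.
Proof.
move=> hU UU cUK; rewrite trnormE -[c]/(complex.Re c%:C); apply: le_Re.
apply: le_trans (mxtrace_mul_le_singular _ hU UU).
apply: (le_trans cUK); apply: real_ler_norm.
(* The trace is real because it exceeds the real [c] by a nonnegative element of the ordered field
   [C]. *)
rewrite -(subrK c%:C (\tr _)) rpredD //.
  by rewrite ger0_real ?subr_ge0.
by apply/complex_realP; exists c.
Qed.

Lemma psdmxP n (A : 'M[C]_n) :
  psdmx A <-> A^t* = A /\ forall v, 0 <= dotc v (A *m v).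
Proof.
split=> -[hA A0]; split.
- by have := is_hermitianmxP _ _ _ hA; rewrite expr0 scale1r.
- by move=> v; rewrite /dotc mulmxA.
- by apply/is_hermitianmxP; rewrite expr0 scale1r.
- by move=> v; have := A0 v; rewrite /dotc mulmxA.
Qed.

Lemma psdmx_proj1mx n (u : 'cV[C]_n) : psdmx (proj1mx u).
Proof.
apply/psdmxP; split=> [|v]; first exact: proj1mx_herm.
by rewrite proj1mx_sandwich exprn_ge0.
Qed.

Lemma psdmxZ n (a : C) (A : 'M[C]_n) : 0 <= a -> psdmx A -> psdmx (a *: A).
Proof.
move=> a0 /psdmxP[hA A0]; apply/psdmxP; split=> [|v].
  by rewrite linearZ map_mxZ /= geC0_conj // hA.
by rewrite -scalemxAl dotcZr mulr_ge0.
Qed.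

Lemma psdmx_delta n (i : 'I_n) : psdmx (delta_mx i i : 'M[C]_n).
Proof.
have -> : delta_mx i i = proj1mx (delta_mx i 0 : 'cV[C]_n).
  by rewrite /proj1mx trmx_delta map_delta_mx mul_delta_mx.
exact: psdmx_proj1mx.
Qed.

Lemma psdmx_trace_le n (A B : 'M[C]_n) (l : C) :
  psdmx B -> (forall v, dotc v (A *m v) <= l * dotc v v) ->
  \tr (B *m A) <= l * \tr B.
Proof.
move=> /psdmxP[hB B0]; apply: mxtrace_psd_le => //.
by apply/normalmxP; rewrite hB.
Qed.

Lemma mxblk_idtens n m d (Phi : 'M[C]_m -> 'M[C]_d) (M : 'M[C]_(n * m)) i j :
  mxblk (idtens Phi M) i j = Phi (mxblk M i j).
Proof.
apply/matrixP => a b; rewrite mxE /idtens summxE (bigD1 i) //= summxE.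
rewrite (bigD1 j) //= mxtens.tensmxE mxE !eqxx mul1r.
rewrite big1 => [|k kj]; last first.
  by rewrite mxtens.tensmxE mxE [_ == k]eq_sym (negPf kj) andbF mul0r.
rewrite addr0 big1 ?addr0 // => k ki; rewrite summxE big1 // => l _.
by rewrite mxtens.tensmxE mxE [_ == k]eq_sym (negPf ki) mul0r.
Qed.

(** A diagonal block is the compression V^* M V by the isometry V = |i> (x) 1, here
    [colsub f 1%:M]. *)
Lemma psdmx_mxblk n d (M : 'M[C]_(n * d)) i : psdmx M -> psdmx (mxblk M i i).
Proof.
move=> /psdmxP[hM M0]; apply/psdmxP; split=> [|v].
  by apply/matrixP => a b; rewrite !mxE -[in RHS]hM !mxE.
pose f (b : 'I_d) := mxtens_index (i, b).
have -> : mxblk M i i = (colsub f 1%:M)^t* *m (M *m colsub f 1%:M).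
  rewrite mulmx_colsub mulmx1 trmx_mxsub map_mxsub trmx1 map_mx1 -rowsubE.
  by apply/matrixP => a b; rewrite !mxE.
by rewrite -!mulmxA dotc_mulr trmxCK.
Qed.

(** Complete positivity is used with a one-dimensional ancilla, whose single block is the operator
    itself. *)
Lemma channel_delta_psd m d (Phi : {linear 'M[C]_m -> 'M[C]_d}) y :
  quantum_channel Phi -> psdmx (Phi (delta_mx y y)).
Proof.
move=> [cpPhi _].
pose k := mxtens_index (ord0 : 'I_1, y).
have /cpPhi /(@psdmx_mxblk _ _ _ ord0) := psdmx_delta k.
rewrite mxblk_idtens; congr (psdmx (Phi _)); apply/matrixP => a b; rewrite !mxE.
by rewrite /k !(can_eq (@mxtens.mxtens_indexK _ _)) !xpair_eqE.
Qed.

Section Cqop.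
Context {X : finType} {d : nat}.
Implicit Types A B : X -> 'M[C]_d.

Lemma cqopE A i j a b :
  cqop A (mxtens_index (i, a)) (mxtens_index (j, b)) =
  (i == j)%:R * A (enum_val i) a b.
Proof.
rewrite /cqop summxE (bigD1 (enum_val i)) //= mxtens.tensmxE mxE enum_valK eqxx.
rewrite [j == i]eq_sym big1 ?addr0 // => x /negPf xi.
rewrite mxtens.tensmxE mxE -(inj_eq enum_val_inj) enum_rankK.
by rewrite [_ == x]eq_sym xi mul0r.
Qed.

Lemma cqop_eqP (M : 'M[C]_(#|X| * d)) A :
  (forall i j a b, M (mxtens_index (i, a)) (mxtens_index (j, b)) =
    (i == j)%:R * A (enum_val i) a b) -> M = cqop A.
Proof.
move=> MA; apply/matrixP => p q.
case: (mxtens.mxtens_indexP p) => i a; case: (mxtens.mxtens_indexP q) => j b.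
by rewrite cqopE.
Qed.

Lemma mxblk_cqop A x : mxblk (cqop A) (enum_rank x) (enum_rank x) = A x.
Proof. by apply/matrixP => a b; rewrite mxE cqopE eqxx mul1r enum_rankK. Qed.

Lemma cqopB A B : cqop A - cqop B = cqop (fun x => A x - B x).
Proof. by apply: cqop_eqP => i j a b; rewrite !mxE !cqopE mulrBr. Qed.

Lemma cqop_trmxC A : (cqop A)^t* = cqop (fun x => (A x)^t*).
Proof.
apply: cqop_eqP => i j a b; rewrite !mxE cqopE rmorphM /= conjC_nat eq_sym.
by case: eqP => [->//|_]; rewrite !mul0r.
Qed.

Lemma cqop1 : cqop (fun _ : X => 1%:M : 'M[C]_d) = 1%:M.
Proof.
symmetry; apply: cqop_eqP => i j a b.
rewrite !mxE (can_eq (@mxtens.mxtens_indexK _ _)) xpair_eqE -natrM.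
by case: eqP; case: eqP.
Qed.

Lemma cqopM A B : cqop A *m cqop B = cqop (fun x => A x *m B x).
Proof.
rewrite /cqop mulmx_suml; apply: eq_bigr => x _.
rewrite mulmx_sumr (bigD1 x) //= mxtens.tensmx_mul mul_delta_mx.
rewrite big1 ?addr0 // => y /negPf yx.
rewrite mxtens.tensmx_mul mul_delta_mx_0 ?mxtens.tens0mx //.
by rewrite (inj_eq enum_rank_inj) eq_sym yx.
Qed.

Lemma mxtrace_cqop A : \tr (cqop A) = \sum_x \tr (A x).
Proof.
rewrite /mxtrace (reindex (@mxtens_index _ _)) /=; last first.
  exists (@mxtens.mxtens_unindex _ _) => p _.
    exact: mxtens.mxtens_indexK.
  exact: mxtens.mxtens_unindexK.
rewrite (eq_bigr (fun p => A (enum_val p.1) p.2 p.2)) => [|[i a] _]; last first.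
  by rewrite cqopE eqxx mul1r.
rewrite -(pair_bigA _ (fun i a => A (enum_val i) a a)) /=.
rewrite (reindex (@enum_rank X)) /=; last exact/onW_bij/enum_rank_bij.
by apply: eq_bigr => x _; rewrite enum_rankK.
Qed.

End Cqop.
End Operators.


(** * Guessing probability of the uniform ensemble and its distance from [CC 2] *)

Section GuessingProbability.
Context {R : realType}.
Local Notation C := R[i].

Lemma le_log2 (k : nat) (p : R) : 0 < p -> p <= (2 ^+ k)^-1 -> k%:R <= - log2 p.
Proof.
move=> p0 pk; have l2 : 0 < ln 2 :> R by rewrite ln_gt0 // ltr1n.
have k0 : 0 < 2 ^+ k :> R by rewrite exprn_gt0.
rewrite /log2 -mulNr ler_pdivlMr // lerNr.
apply: (@le_trans _ _ (ln ((2 ^+ k)^-1))).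
  by rewrite ler_ln // posrE invr_gt0.
by rewrite lnV ?posrE // lnXn // mulr_natl.
Qed.

Lemma log2_le (k : nat) (p : R) : k%:R <= - log2 p -> p <= (2 ^+ k)^-1.
Proof.
move=> kp; have l2 : 0 < ln 2 :> R by rewrite ln_gt0 // ltr1n.
have k0 : 0 < 2 ^+ k :> R by rewrite exprn_gt0.
have [p0|p0] := leP p 0; first by rewrite (le_trans p0) // invr_ge0 ltW.
rewrite -ler_ln ?posrE ?invr_gt0 // lnV ?posrE // lnXn //.
rewrite -[ln 2 *+ k]mulr_natl lerNr.
by move: kp; rewrite /log2 -mulNr ler_pdivlMr.
Qed.

Section PureStates.
Context {X : finType} {d : nat} (psi : X -> 'cV[C]_d).
Hypothesis psi1 : forall x, dotc (psi x) (psi x) = 1.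
Variable x0 : X.

Definition pure_state (x : X) : 'M[C]_d := #|X|%:R^-1 *: proj1mx (psi x).

Let N0 : 0 < #|X|%:R :> C.
Proof. by rewrite ltr0n; apply/card_gt0P; exists x0. Qed.

Lemma cqstate_pure_state : cqstate pure_state.
Proof.
split=> [x|]; first by apply: psdmxZ (psdmx_proj1mx _); rewrite invr_ge0.
rewrite (eq_bigr (fun=> #|X|%:R^-1)) => [|x _].
  by rewrite sumr_const -[LHS]mulr_natl divff // gt_eqF.
by rewrite mxtraceZ mxtrace_proj1mx psi1 mulr1.
Qed.

Lemma proj1mx_le1 x (v : 'cV[C]_d) :
  dotc v (proj1mx (psi x) *m v) <= 1 * dotc v v.
Proof.
rewrite proj1mx_sandwich; apply: le_trans (dotc_CauchySchwarz _ _) _.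
by rewrite psi1.
Qed.

Let values := [set complex.Re (\sum_(x : X) \tr (M x *m pure_state x)) |
  M in povm (d := d)].

(** Each projector is at most the identity, so the success sum is at most the total trace of the
    POVM over |X|, and that trace is [d] by completeness. *)
Let values_ub : ubound values (d%:R / #|X|%:R).
Proof.
move=> _ [M [M0 M1] <-].
have -> : d%:R / #|X|%:R = complex.Re (d%:R / #|X|%:R : C).
  by rewrite -!(rmorph_nat (real_complex R)) -fmorphV -rmorphM.
apply: le_Re.
rewrite -(mxtrace1 C d) -M1 raddf_sum /= mulr_suml; apply: ler_sum => x _.
rewrite -scalemxAr mxtraceZ mulrC ler_pM2r ?invr_gt0 //.
rewrite -[leRHS]mul1r; apply: psdmx_trace_le => //; exact: proj1mx_le1.
Qed.

(** The strategy that always answers [x0] makes the set of success values nonempty and wins with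
    probability 1/|X|. *)
Let povm0 : povm (fun x : X => if x == x0 then 1%:M else 0 : 'M[C]_d).
Proof.
split=> [x|]; last first.
  by rewrite (bigD1 x0) //= eqxx big1 ?addr0 // => x /negPf ->.
apply/psdmxP; case: eqP => _; split=> [|v].
- by rewrite trmx1 map_mx1.
- by rewrite mul1mx dotc_ge0.
- by rewrite trmx0 map_mx0.
- by rewrite mul0mx /dotc mulmx0 mxE.
Qed.

Let values0 : values (#|X|%:R^-1).
Proof.
exists (fun x : X => if x == x0 then 1%:M else 0 : 'M[C]_d); first exact: povm0.
rewrite (bigD1 x0) //= eqxx big1 ?addr0 => [|x /negPf ->]; last first.
  by rewrite mul0mx mxtrace0.
rewrite mul1mx mxtraceZ mxtrace_proj1mx psi1 mulr1.
by rewrite -(rmorph_nat (real_complex R)) -fmorphV.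
Qed.

Lemma pguess_pure_state_le : pguess pure_state <= d%:R / #|X|%:R.
Proof. by apply: ge_sup values_ub; exists (#|X|%:R^-1). Qed.

(** Passing to [log2] needs this, since [ln] takes the default value 0 at nonpositive arguments. *)
Lemma pguess_pure_state_gt0 : 0 < pguess pure_state.
Proof.
apply: (@lt_le_trans _ _ (#|X|%:R^-1)).
  by rewrite invr_gt0 ltr0n; apply/card_gt0P; exists x0.
by apply: ub_le_sup values0; exists (d%:R / #|X|%:R).
Qed.

Hypothesis psi_eps : forall x y, x != y -> `|dotc (psi x) (psi y)| <= 4^-1.

Lemma mxtrace_proj_CC (sigma : X -> 'M[C]_d) :
  CC 2 sigma -> \sum_x \tr (proj1mx (psi x) *m sigma x) <= 2^-1.
Proof.
move=> [_ [m [P [Phi [[P0 P1] Pk qPhi sE]]]]].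
(* Comparing diagonal blocks gives the mixture of the states tau_y = [Phi (delta_mx y y)]. *)
have {}sE x : sigma x = \sum_(y < m) (P x y)%:C *: Phi (delta_mx y y).
  rewrite -(mxblk_cqop sigma x) sE mxblk_idtens mxblk_cqop linear_sum.
  by apply: eq_bigr => y _; rewrite linearZ.
have Pk4 := log2_le (k := 2) Pk.
have trPhi y : \tr (Phi (delta_mx y y)) = 1.
  rewrite (proj2 qPhi) /mxtrace (bigD1 y) //= mxE !eqxx big1 ?addr0 // => z.
  by move=> /negPf zy; rewrite mxE zy.
under eq_bigr => x _.
  rewrite mxtrace_mulC sE mulmx_suml raddf_sum /=.
  under eq_bigr => y _ do rewrite -scalemxAl scalemxAr.
  over.
rewrite exchange_big /=; under eq_bigr do rewrite -raddf_sum -mulmx_sumr /=.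
pose q y := \sum_x (P x y)%:C.
pose pm y := \big[Num.max/0]_(x : X) P x y.
(* For fixed [y] the operator bound is tested against tau_y, of trace 1. Summed over [y], the maxima
   give the guessing probability, at most 1/4, and the marginals [q] sum to 1. *)
apply: (@le_trans _ _ (\sum_y ((pm y)%:C + 4^-1 * q y))).
  apply: ler_sum => y _; rewrite -[leRHS]mulr1 -[X in _ <= _ * X](trPhi y).
  apply: psdmx_trace_le; first exact: channel_delta_psd.
  move=> v; apply: nearly_orthogonal_opbound => //.
  - by rewrite ler0c bigmax_ge_id.
  - by move=> x; rewrite ler0c lecR P0 le_bigmax.
rewrite big_split /= -mulr_sumr /q exchange_big /=.
have -> : \sum_x \sum_y (P x y)%:C = 1.
  rewrite -(rmorph1 (real_complex R)) -P1 rmorph_sum; apply: eq_bigr => x _.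
  by rewrite rmorph_sum.
rewrite -rmorph_sum /= -/(pguess_cl P).
have -> : 2^-1 = 4^-1 + 4^-1 * 1 :> C by field.
rewrite lerD2r (_ : 4^-1 = ((2 ^+ 2)^-1 : R)%:C); first by rewrite lecR.
by rewrite fmorphV rmorphXn /= rmorph_nat -natrX.
Qed.

Lemma trdist_pure_state : (1%:E <= trdist pure_state (CC 2))%E.
Proof.
apply: le_ereal_inf_tmp => _ [sigma sCC <-]; rewrite lee_fin.
have [[_ sigma1] _] := sCC.
pose U x := 2 *: proj1mx (psi x) - 1%:M.
apply: (@trnorm_ge _ _ (cqop U)).
- rewrite cqop_trmxC; congr cqop; apply/funext => x.
  rewrite /U linearB linearZ /= map_mxB map_mxZ /= proj1mx_herm trmx1 map_mx1.
  by rewrite conjC_nat.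
- rewrite cqopM -cqop1; congr cqop; apply/funext => x; rewrite /U.
  rewrite mulmxBl mulmxBr mul1mx !mulmx1 -scalemxAl -scalemxAr proj1mx_idem //.
  by rewrite !scaler_nat [_ *+ 2 *+ 2]mulr2n addrK opprB addrC subrK.
rewrite cqopB cqopM mxtrace_cqop.
(* T fixes the given state and both states have trace 1, so the reflection 2 T - 1 yields twice the
   gap between the overlaps 1 and Tr (T sigma). *)
have -> : \sum_x \tr (U x *m (pure_state x - sigma x)) =
  2 * (1 - \sum_x \tr (proj1mx (psi x) *m sigma x)).
  transitivity (\sum_x (\tr (pure_state x) + \tr (sigma x)
      - 2 * \tr (proj1mx (psi x) *m sigma x))); last first.
    rewrite !big_split /= (proj2 cqstate_pure_state) sigma1 sumrN -mulr_sumr.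
    by rewrite mulrBr mulr1.
  apply: eq_bigr => x _; rewrite /U mulmxBl mul1mx -scalemxAl mulmxBr.
  have -> : proj1mx (psi x) *m pure_state x = pure_state x.
    by rewrite /pure_state -scalemxAr proj1mx_idem.
  by rewrite !raddfB /= !(mxtraceZ 2); ring.
rewrite rmorph1 -ler_pdivrMl // mulr1 lerBrDr -lerBrDl.
have -> : 1 - 2^-1 = 2^-1 :> C by field.
exact: mxtrace_proj_CC.
Qed.

End PureStates.
End GuessingProbability.

(** * Choice of parameters and the asymptotics of the source length *)

Section SourceLength.

(** The additive 5 leaves room for 4 (r - 1) <= 2^m at every positive [k], small values included. *)
Definition field_exponent (k : nat) := (trunc_log 2 k + 5)%N.
(** One extra unit makes up for the rounded division; the other two pay for the dimension 2^(2 m) in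
    the guessing bound. *)
Definition degree_bound (k : nat) := (k %/ field_exponent k + 3)%N.
Definition source_length (k : nat) := (field_exponent k * degree_bound k)%N.

Lemma source_length_ge k : (k + 2 * field_exponent k <= source_length k)%N.
Proof.
have m0 : (0 < field_exponent k)%N by rewrite addn_gt0 orbT.
rewrite /source_length /degree_bound.
have := divn_eq k (field_exponent k); have := ltn_pmod k m0; nia.
Qed.

Lemma source_length_le k : (source_length k <= k + 3 * field_exponent k)%N.
Proof.
rewrite /source_length /degree_bound.
have := divn_eq k (field_exponent k); nia.
Qed.

Lemma degree_bound_le k :
  (0 < k)%N -> (4 * (degree_bound k).-1 <= 2 ^ field_exponent k)%N.
Proof.
move=> k0; rewrite /degree_bound.
have : (k %/ field_exponent k <= k)%N by apply: leq_div.
have := trunc_log_ltn k (isT : (1 < 2)%N).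
rewrite expnS /field_exponent expnD (_ : 2 ^ 5 = 32)%N //.
by move: (2 ^ trunc_log 2 k)%N (k %/ _)%N => a b; lia.
Qed.

(** A bound of order sqrt k on the exponent suffices for m / k -> 0. It reduces to (t + 5)^2 <= 25 *
    2^t, an equality at t = 0. *)
Lemma sqr_field_exponent_le k :
  (0 < k)%N -> (field_exponent k ^ 2 <= 25 * k)%N.
Proof.
move=> k0.
apply: leq_trans (leq_mul (leqnn 25) (trunc_logP (isT : (1 < 2)%N) k0)).
rewrite /field_exponent; elim: (trunc_log 2 k) => [//|t IH].
by rewrite [(2 ^ t.+1)%N]expnS -!mulnn in IH *; move: (2 ^ t)%N IH => a; nia.
Qed.

Lemma source_length_rate (R : realType) :
  (fun k => (source_length k)%:R / k%:R - 1 : R) @ \oo --> (0 : R).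
Proof.
apply/cvgrPdist_lt => eps eps0.
(* Here 225 = 9 * 25: the excess length is at most 3 m, whose square is at most 225 k, so k x^2 <=
   225 for the relative excess x. *)
exists (Num.bound (225 / eps ^+ 2)).+1 => // k /= Nk.
have k0 : (0 < k)%N by apply: leq_trans Nk.
have kR : 0 < k%:R :> R by rewrite ltr0n.
have e2 : 0 < eps ^+ 2 by rewrite exprn_gt0.
have keps : 225 < k%:R * eps ^+ 2.
  rewrite -ltr_pdivrMr //; apply: lt_le_trans (_ : _ < _) _.
    by apply: archi_boundP; rewrite divr_ge0 ?ltW.
  by rewrite ler_nat ltnW.
rewrite sub0r normrN.
set x := _ - 1; have xk : x * k%:R = (source_length k)%:R - k%:R.
  by rewrite /x mulrBl divfK ?mul1r // gt_eqF.
have lo : k%:R <= (source_length k)%:R :> R.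
  by rewrite ler_nat (leq_trans _ (source_length_ge k)) // leq_addr.
have hi : (source_length k)%:R <= k%:R + 3 * (field_exponent k)%:R :> R.
  by rewrite -natrM -natrD ler_nat source_length_le.
have m2 : (field_exponent k)%:R ^+ 2 <= 25 * k%:R :> R.
  by rewrite -natrX -natrM ler_nat sqr_field_exponent_le.
have x0 : 0 <= x by rewrite -(pmulr_lge0 _ kR) xk subr_ge0.
rewrite ger0_norm // -(ltr_pXn2r (ltn0Sn 1)) ?nnegrE ?(ltW eps0) //.
rewrite -(ltr_pM2l kR); apply: le_lt_trans keps.
rewrite -(ler_pM2r kR).
have -> : k%:R * x ^+ 2 * k%:R = (x * k%:R) ^+ 2 by ring.
apply: (@le_trans _ _ ((3 * (field_exponent k)%:R) ^+ 2)); last by lra.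
by rewrite ler_pXn2r ?nnegrE ?mulr_ge0 // xk lerBlDl.
Qed.

End SourceLength.

(** * Assembly of the state from the code and the parameters *)

Theorem theorem6p2 (R : realType) :
  exists n : nat -> nat,
    (exists2 e : nat -> R, e @ \oo --> (0 : R) &
       forall k : nat, (0 < k)%N -> (n k)%:R = k%:R * (1 + e k)) /\
    forall k : nat, (0 < k)%N ->
      exists (d : nat) (rho : (n k).-tuple bool -> 'M[R[i]]_d),
        CQ k%:R rho /\
        ((98%:R / 100%:R : R)%:E <= trdist rho (CC 2))%E.
Proof.
exists source_length; split.
  exists (fun k => (source_length k)%:R / k%:R - 1).
    exact: source_length_rate.
  by move=> k k0; rewrite addrC subrK mulrC divfK // pnatr_eq0 -lt0n.
move=> k k0; have m0 : (0 < field_exponent k)%N by rewrite addn_gt0 orbT.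
pose X := (source_length k).-tuple bool.
have cX : #|{: X}| = (2 ^ source_length k)%N by rewrite card_tuple card_bool.
have [|d [dE [psi [psi1 psi_eps]]]] := @exists_nearly_orthogonal R[i] X
  (field_exponent k) (degree_bound k) m0 _ (degree_bound_le k0).
  by rewrite cX.
have x0 : X := [tuple of nseq (source_length k) false].
exists d, (pure_state psi); split; last first.
  apply: le_trans (trdist_pure_state psi1 x0 psi_eps).
  by rewrite lee_fin; lra.
split; first exact: cqstate_pure_state.
apply: le_log2; first exact: pguess_pure_state_gt0.
apply: le_trans (pguess_pure_state_le psi1 x0) _.
have p2 j : 0 < 2 ^+ j :> R by rewrite exprn_gt0.
(* The bound 2^(2 m) / 2^(m r) <= 2^(-k) becomes the exponent inequality k + 2 m <= m r. *)
rewrite cX dE !natrX ler_pdivrMr // mulrC ler_pdivlMr // -exprD.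
rewrite ler_eXn2l ?ltr1n // addnn -mul2n addnC.
exact: source_length_ge.
Qed.
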